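(* There is a two-dimensional model for the contravariant classifying space of the category $\mathcal{RF}$.
   Context: $\mathbb{N}=\{0,1,2,\ldots\}$. The category $\mathcal{RF}$ has object set $\mathbb{N}$; the set of morphisms from $m$ to $n$ is $\{(i,j)\in\mathbb{N}\times\mathbb{N}\mid i+j=n-m\}$ (empty if $m>n$); the identity of $n$ is $(0,0)$; the composition of $(i_0,j_0)\colon n_0\to n_1$ and $(i_1,j_1)\colon n_1\to n_2$ is $(i_0+i_1,j_0+j_1)\colon n_0\to n_2$. For a small category $\mathcal{I}$, a contravariant $\mathcal{I}$-space is a contravariant functor from $\mathcal{I}$ to (compactly generated) spaces. A contravariant $\mathcal{I}$-CW-complex is a contravariant $\mathcal{I}$-space $X$ together with a filtration $\emptyset=X_{-1}\subset X_0\subset X_1\subset\cdots\subset X=\bigcup_{n\ge 0} X_n$ such that $X=\mathrm{colim}_{n\to\infty}X_n$ and for each $n\ge0$ the $\mathcal{I}$-space $X_n$ is obtained from $X_{n-1}$ by a pushout of $\mathcal{I}$-spaces attaching $\coprod_{i\in I_n}\mathrm{mor}_{\mathcal{I}}(-,c_i)\times D^n$ along $\coprod_{i\in I_n}\mathrm{mor}_{\mathcal{I}}(-,c_i)\times S^{n-1}$, for some index set $I_n$ and objects $c_i$ of $\mathcal{I}$. It is two-dimensional if $X=X_2$. A contravariant classifying space for $\mathcal{I}$ is a contravariant $\mathcal{I}$-CW-complex whose evaluation at each object of $\mathcal{I}$ is a contractible space. *)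

(* Defs.v *)
From HB Require Import structures.
From mathcomp Require Import all_boot all_order all_algebra.
From mathcomp Require Import all_classical all_reals topology normedtype.
From mathcomp Require Import zify.

Set Implicit Arguments.
Unset Strict Implicit.
Unset Printing Implicit Defensive.

Import Order.TTheory GRing.Theory Num.Theory.
Import numFieldNormedType.Exports.

Local Open Scope classical_set_scope.
Local Open Scope ring_scope.

(* Hom-sets are [choiceType]s because [discrete_topology] asks for one;
   classically every type is one.  [ccomp f g] is "first f, then g". *)
Record small_category := SmallCategory {
  cobj :> Type;
  chom : cobj -> cobj -> choiceType;
  cid : forall a, chom a a;
  ccomp : forall a b c, chom a b -> chom b c -> chom a c;
  ccomp1f : forall a b (f : chom a b), ccomp (cid a) f = f;
  ccompf1 : forall a b (f : chom a b), ccomp f (cid b) = f;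
  ccompA : forall a b c d (f : chom a b) (g : chom b c) (h : chom c d),
    ccomp f (ccomp g h) = ccomp (ccomp f g) h
}.

Section RF.

Definition RF_hom (m n : nat) : Type :=
  {ij : nat * nat | (ij.1 + ij.2)%N%:Z == n%:Z - m%:Z}.

HB.instance Definition _ m n := Choice.on (RF_hom m n).

Lemma RF_id_subproof n : ((0 + 0)%N%:Z == n%:Z - n%:Z).
Proof. by rewrite subrr. Qed.

Definition RF_id n : RF_hom n n := exist _ (0%N, 0%N) (RF_id_subproof n).

Lemma RF_comp_subproof n0 n1 n2 (f : RF_hom n0 n1) (g : RF_hom n1 n2) :
  (((\val f).1 + (\val g).1) + ((\val f).2 + (\val g).2))%N%:Z
    == n2%:Z - n0%:Z.
Proof. by case: f g => [[i0 j0] /= h0] [[i1 j1] /= h1]; lia. Qed.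

Definition RF_comp n0 n1 n2 (f : RF_hom n0 n1) (g : RF_hom n1 n2) :
    RF_hom n0 n2 :=
  exist _ (((\val f).1 + (\val g).1)%N, ((\val f).2 + (\val g).2)%N)
    (RF_comp_subproof f g).

Lemma RF_comp1f m n (f : RF_hom m n) : RF_comp (RF_id m) f = f.
Proof. by apply: val_inj; case: f => [[i j] ?]. Qed.

Lemma RF_compf1 m n (f : RF_hom m n) : RF_comp f (RF_id n) = f.
Proof. by apply: val_inj; case: f => [[i j] ?] /=; rewrite !addn0. Qed.

Lemma RF_compA a b c d (f : RF_hom a b) (g : RF_hom b c) (h : RF_hom c d) :
  RF_comp f (RF_comp g h) = RF_comp (RF_comp f g) h.
Proof. by apply: val_inj; rewrite /= !addnA. Qed.

Definition RF : small_category :=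
  @SmallCategory nat (fun m n => RF_hom m n : choiceType)
    RF_id RF_comp RF_comp1f RF_compf1 RF_compA.

End RF.

(* Steenrod's notion: Hausdorff, and closedness is tested on compact sets. *)
Definition compactly_generated (T : topologicalType) : Prop :=
  hausdorff_space T /\
  forall A : set T, (forall K, compact K -> closed (A `&` K)) -> closed A.

Section compactly_generated_facts.

Lemma inj_hausdorff (S T : topologicalType) (f : S -> T) :
  continuous f -> injective f -> hausdorff_space T -> hausdorff_space S.
Proof.
move=> cf If hT p q pq; apply: If; apply: hT => A B Ap Bq.
by have [z [? ?]] := pq _ _ (cf _ _ Ap) (cf _ _ Bq); exists (f z).
Qed.

Lemma prod_hausdorff (S T : topologicalType) :
  hausdorff_space S -> hausdorff_space T -> hausdorff_space (S * T)%type.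
Proof.
move=> hS hT [p1 p2] [q1 q2] pq; congr pair.
  apply: hS => A B Ap Bq.
  have [z [? ?]] := pq (fst @^-1` A) (fst @^-1` B)
    (@cvg_fst _ _ (nbhs p1) (nbhs p2) _ _ Ap)
    (@cvg_fst _ _ (nbhs q1) (nbhs q2) _ _ Bq).
  by exists z.1.
apply: hT => A B Ap Bq.
have [z [? ?]] := pq (snd @^-1` A) (snd @^-1` B)
  (@cvg_snd _ _ (nbhs p1) (nbhs p2) _ _ Ap)
  (@cvg_snd _ _ (nbhs q1) (nbhs q2) _ _ Bq).
by exists z.2.
Qed.

Lemma pair_map_continuous (S S' T T' : topologicalType)
    (f : S -> S') (g : T -> T') :
  continuous f -> continuous g ->
  continuous (fun x : S * T => (f x.1, g x.2)).
Proof.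
move=> cf cg [x y] A [[P Q] /= [Px Qy] PQA].
exists (f @^-1` P, g @^-1` Q); first by split; [exact: cf | exact: cg].
by move=> [z t] /= [Pz Qt]; apply: PQA.
Qed.

Lemma discrete_continuous (S : discreteTopologicalType) (T : topologicalType)
  (f : S -> T) : continuous f.
Proof.
by move=> x A /nbhs_singleton Ax; apply: filterS (discrete_set1 x) => _ ->.
Qed.

Lemma compact_nbhs_compactly_generated (T : topologicalType) :
  hausdorff_space T -> (forall x : T, exists2 K, nbhs x K & compact K) ->
  compactly_generated T.
Proof.
move=> hT lcT; split=> // A cA x clx.
have [K Kx cK] := lcT x.
have : closure (A `&` K) x.
  move=> B Bx; have [y [Ay [Ky By]]] := clx _ (filterI Kx Bx).
  by exists y.
by rewrite -(closure_id _).1; [case | exact: cA].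
Qed.

End compactly_generated_facts.

(* Contravariant functors from C to compactly generated spaces. *)
Record ispace (C : small_category) := ISpace {
  isp :> C -> topologicalType;
  isp_cg : forall a, compactly_generated (isp a);
  ires : forall a b, chom a b -> isp b -> isp a;
  ires_continuous : forall a b (f : chom a b), continuous (ires f);
  ires_id : forall a (x : isp a), ires (cid a) x = x;
  ires_comp : forall a b c (f : chom a b) (g : chom b c) (x : isp c),
    ires (ccomp f g) x = ires f (ires g x)
}.

Record imap (C : small_category) (X Y : ispace C) := IMap {
  imap_fun :> forall a, X a -> Y a;
  imap_continuous : forall a, continuous (@imap_fun a);
  imap_natural : forall a b (f : chom a b) (x : X b),
    imap_fun (ires f x) = ires f (imap_fun x)
}.

Definition imap_eq C (X Y : ispace C) (f g : imap X Y) : Prop :=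
  forall a (x : X a), f a x = g a x.

Lemma imap_comp_continuous C (X Y Z : ispace C) (g : imap Y Z) (f : imap X Y) a :
  continuous (fun x : X a => g a (f a x)).
Proof.
by move=> x; apply: continuous_comp; apply: imap_continuous.
Qed.

Lemma imap_comp_natural C (X Y Z : ispace C) (g : imap Y Z) (f : imap X Y)
  a b (h : chom a b) (x : X b) : g a (f a (ires h x)) = ires h (g b (f b x)).
Proof. by rewrite !imap_natural. Qed.

Definition imap_comp C (X Y Z : ispace C) (g : imap Y Z) (f : imap X Y) :
    imap X Z :=
  IMap (@imap_comp_continuous C X Y Z g f) (@imap_comp_natural C X Y Z g f).

(* The square
     A  --f--> B
     |g        |h
     A' --k--> B'
   is a pushout in the category of contravariant C-spaces. *)
Definition is_pushout C (A B A' B' : ispace C)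
    (f : imap A B) (g : imap A A') (h : imap B B') (k : imap A' B') : Prop :=
  imap_eq (imap_comp h f) (imap_comp k g) /\
  forall (Z : ispace C) (u : imap B Z) (v : imap A' Z),
    imap_eq (imap_comp u f) (imap_comp v g) ->
    exists w : imap B' Z,
      [/\ imap_eq (imap_comp w h) u, imap_eq (imap_comp w k) v &
        forall w' : imap B' Z, imap_eq (imap_comp w' h) u ->
          imap_eq (imap_comp w' k) v -> imap_eq w' w].

(* Sub-C-spaces, each value carrying the subspace topology. *)
Record sub_ispace C (X : ispace C) := SubISpace {
  sub_set : forall a, set (X a);
  sub_stable : forall a b (f : chom a b) (x : X b),
    sub_set x -> sub_set (ires f x);
  sub_cg : forall a, compactly_generated (@sub_set a)
}.
Arguments sub_set {C X} s a.

Section sub_ispace_facts.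
Context (C : small_category) (X : ispace C).

Lemma set_val_continuous (T : topologicalType) (A : set T) :
  continuous (set_val : A -> T).
Proof. exact: initial_continuous. Qed.

Lemma to_set_type_continuous (S T : topologicalType) (A : set T) (f : S -> A) :
  continuous (fun x => set_val (f x)) -> continuous f.
Proof. by move=> cf; apply: continuous_comp_initial. Qed.

Section one.
Variable A : sub_ispace X.

Definition sub_res a b (f : chom a b) (x : sub_set A b) : sub_set A a :=
  exist _ (ires f (set_val x)) (mem_set (sub_stable f (set_valP x))).

Lemma sub_res_continuous a b (f : chom a b) : continuous (sub_res f).
Proof.
apply: to_set_type_continuous => x.
apply: (@continuous_comp _ _ _ set_val (ires f)).
  exact: set_val_continuous.
exact: ires_continuous.
Qed.

Lemma sub_res_id a (x : sub_set A a) : sub_res (cid a) x = x.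
Proof. by apply: val_inj => /=; rewrite ires_id. Qed.

Lemma sub_res_comp a b c (f : chom a b) (g : chom b c) (x : sub_set A c) :
  sub_res (ccomp f g) x = sub_res f (sub_res g x).
Proof. by apply: val_inj => /=; rewrite ires_comp. Qed.

Definition ispace_of_sub : ispace C :=
  ISpace (sub_cg A) sub_res_continuous sub_res_id sub_res_comp.

Lemma sub_val_continuous a : continuous (set_val : ispace_of_sub a -> X a).
Proof. exact: set_val_continuous. Qed.

Definition sub_val : imap ispace_of_sub X :=
  @IMap C ispace_of_sub X (fun a => set_val) sub_val_continuous
    (fun a b f x => erefl).

End one.

Definition sub_le (A B : sub_ispace X) : Prop :=
  forall a, sub_set A a `<=` sub_set B a.

Section incl.
Variables (A B : sub_ispace X) (AB : sub_le A B).

Definition sub_incl_fun a (x : ispace_of_sub A a) : ispace_of_sub B a :=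
  exist _ (set_val x) (mem_set (AB (set_valP x))).

Lemma sub_incl_continuous a : continuous (@sub_incl_fun a).
Proof. by apply: to_set_type_continuous; apply: set_val_continuous. Qed.

Lemma sub_incl_natural a b (f : chom a b) (x : ispace_of_sub A b) :
  sub_incl_fun (ires f x) = ires f (sub_incl_fun x).
Proof. exact: val_inj. Qed.

Definition sub_incl : imap (ispace_of_sub A) (ispace_of_sub B) :=
  IMap sub_incl_continuous sub_incl_natural.

End incl.
End sub_ispace_facts.

(* X, with the inclusions of the A n, is the colimit of A 0 -> A 1 -> ... in
   the category of contravariant C-spaces. *)
Definition is_seq_colim C (X : ispace C) (A : nat -> sub_ispace X)
    (leA : forall n, sub_le (A n) (A n.+1)) : Prop :=
  forall (Z : ispace C) (g : forall n, imap (ispace_of_sub (A n)) Z),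
    (forall n, imap_eq (imap_comp (g n.+1) (sub_incl (leA n))) (g n)) ->
    exists w : imap X Z,
      (forall n, imap_eq (imap_comp w (sub_val (A n))) (g n)) /\
      forall w' : imap X Z,
        (forall n, imap_eq (imap_comp w' (sub_val (A n))) (g n)) ->
        imap_eq w' w.

Record compact_hausdorff := CompactHausdorff {
  ch_sort :> topologicalType;
  ch_compact : compact [set: ch_sort];
  ch_hausdorff : hausdorff_space ch_sort
}.

(* The C-space \coprod_(i : I) mor(-, c i) x K.  As K is compact Hausdorff and
   the morphism sets are discrete, the product topology is already the
   compactly generated one. *)
Section cells.
Context (C : small_category) (I : choiceType) (c : I -> C).
Variable K : compact_hausdorff.

Definition cells_sort (a : C) : topologicalType :=
  {i : I & (discrete_topology (chom a (c i)) * K)%type}.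

Lemma cells_cg a : compactly_generated (cells_sort a).
Proof.
apply: compact_nbhs_compactly_generated.
  apply: sigT_hausdorff => i; apply: prod_hausdorff (@ch_hausdorff K).
  exact: discrete_hausdorff.
move=> [i [f x]].
exists (existT _ i @` ([set f] `*` [set: K])).
  apply: existT_nbhs; exists ([set f], [set: K]) => //=; split.
    exact: discrete_set1.
  exact: filterT.
apply: continuous_compact.
  by apply: continuous_subspaceT; apply: existT_continuous.
by apply: compact_setX (@ch_compact K); exact: compact_set1.
Qed.

Definition cells_res a b (f : chom a b) (x : cells_sort b) : cells_sort a :=
  existT _ (projT1 x) (ccomp f (projT2 x).1 : discrete_topology _, (projT2 x).2).

Lemma cells_res_continuous a b (f : chom a b) : continuous (cells_res f).
Proof.
move=> [i y]; pose D d := discrete_topology (chom d (c i)).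
suff /(_ y) : continuous (fun x : D b * K =>
  existT (fun j => (discrete_topology (chom a (c j)) * K)%type) i
    (ccomp f x.1 : D a, x.2)) by [].
move=> x; apply: (@continuous_comp _ _ _
  (fun x : D b * K => (ccomp f x.1 : D a, x.2))
  (existT (fun j => (discrete_topology (chom a (c j)) * K)%type) i));
  last exact: existT_continuous.
apply: (@pair_map_continuous (D b) (D a) K K (ccomp f) id).
  exact: discrete_continuous.
by move=> z.
Qed.

Lemma cells_res_id a (x : cells_sort a) : cells_res (cid a) x = x.
Proof. by case: x => i [g x]; rewrite /cells_res /= ccomp1f. Qed.

Lemma cells_res_comp a b d (f : chom a b) (g : chom b d) (x : cells_sort d) :
  cells_res (ccomp f g) x = cells_res f (cells_res g x).
Proof. by rewrite /cells_res /= ccompA. Qed.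

Definition cells : ispace C :=
  ISpace cells_cg cells_res_continuous cells_res_id cells_res_comp.

End cells.

Section cells_map.
Context (C : small_category) (I : choiceType) (c : I -> C).
Variables (K L : compact_hausdorff) (h : K -> L) (ch : continuous h).

Definition cells_map_fun a (x : cells c K a) : cells c L a :=
  existT _ (projT1 x) ((projT2 x).1, h (projT2 x).2).

Lemma cells_map_continuous a : continuous (@cells_map_fun a).
Proof.
move=> [i y]; pose D := discrete_topology (chom a (c i)).
suff /(_ y) : continuous (fun x : D * K =>
  existT (fun j => (discrete_topology (chom a (c j)) * L)%type) i
    (x.1, h x.2)) by [].
move=> x; apply: (@continuous_comp _ _ _
  (fun x : D * K => (x.1, h x.2))
  (existT (fun j => (discrete_topology (chom a (c j)) * L)%type) i));
  last exact: existT_continuous.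
by apply: (@pair_map_continuous D D K L id h) => // z.
Qed.

Definition cells_map : imap (cells c K) (cells c L) :=
  IMap cells_map_continuous (fun a b f x => erefl).

End cells_map.

(* 'rV[R]_n carries the product topology; discs and spheres are Euclidean, not
   those of the supremum norm.  For n = 0 the sphere is S^{-1}, i.e., empty. *)
Section disc_sphere.
Context (R : realType).

Definition sqnorm n (x : 'rV[R]_n) : R := \sum_(i < n) x 0 i ^+ 2.

Definition disc_set n : set 'rV[R]_n := [set x | sqnorm x <= 1].
Definition sphere_set n : set 'rV[R]_n := [set x | sqnorm x = 1].
Arguments disc_set : clear implicits.
Arguments sphere_set : clear implicits.

Lemma sqnorm_continuous n : continuous (@sqnorm n).
Proof.
apply: continuous_big => [|i _]; first exact: add_continuous.
move=> x; under eq_fun do rewrite expr2.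
by apply: continuousM; exact: coord_continuous.
Qed.

Lemma disc_closed n : closed (disc_set n).
Proof.
rewrite (_ : disc_set n = @sqnorm n @^-1` [set t | t <= 1]) //.
apply: preimage_closed; first by move=> x _; exact: sqnorm_continuous.
exact: closed_le.
Qed.

Lemma sphere_closed n : closed (sphere_set n).
Proof.
rewrite (_ : sphere_set n = @sqnorm n @^-1` [set t | t = 1]) //.
apply: preimage_closed; first by move=> x _; exact: sqnorm_continuous.
exact: closed_eq.
Qed.

Lemma sphere_sub_disc n : sphere_set n `<=` disc_set n.
Proof. by move=> x; rewrite /disc_set /sphere_set /= => ->. Qed.

Lemma disc_compact n : compact (disc_set n).
Proof.
have cB : compact [set v : 'rV[R]_n | forall i, `[-1, 1]%classic (v 0 i)].
  apply: (@rV_compact R n (fun=> `[-1, 1]%classic)) => i.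
  exact: segment_compact.
apply: subclosed_compact (@disc_closed n) cB _ => x xD i /=.
rewrite in_itv /= -ler_norml -(ler_pXn2r (n := 2)) ?nnegrE//.
rewrite real_normK ?num_real// expr1n (le_trans _ xD)// /sqnorm (bigD1 i)//=.
by rewrite lerDl sumr_ge0// => j _; exact: sqr_ge0.
Qed.

Lemma sphere_compact n : compact (sphere_set n).
Proof.
exact: subclosed_compact (@sphere_closed n) (@disc_compact n) (@sphere_sub_disc n).
Qed.

Lemma set_type_compact (T : topologicalType) (A : set T) :
  compact A -> compact [set: A].
Proof.
move=> cA F FF _.
have [|x [Ax clx]] := cA (set_val @ F) _.
  rewrite (_ : (set_val @ F) A = F setT); first exact: filterT.
  by congr F; apply/seteqP; split=> // y _ /=; exact: set_valP.
exists (exist _ x (mem_set Ax)); split=> // P Q FP.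
rewrite nbhsE => -[V [[W oW WV] Vx] VQ].
have Wx : nbhs x W.
  by apply: open_nbhs_nbhs; split=> //; move: Vx; rewrite -WV.
have [y [[z Pz <-] Wz]] := clx _ _ (filterS (@preimage_image _ _ set_val P) FP) Wx.
by exists z; split=> //; apply: VQ; rewrite -WV.
Qed.

Lemma rV_hausdorff n : hausdorff_space 'rV[R]_n.
Proof.
move=> p q pq; apply/rowP => i; apply: (@Rhausdorff R) => A B Ap Bq.
have [z [? ?]] := pq _ _ (@coord_continuous _ _ _ 0 i p A Ap)
  (@coord_continuous _ _ _ 0 i q B Bq).
by exists (z 0 i).
Qed.

Lemma set_type_hausdorff (T : topologicalType) (A : set T) :
  hausdorff_space T -> hausdorff_space A.
Proof.
by apply: inj_hausdorff (@set_val_continuous _ A) _; exact: val_inj.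
Qed.

Definition disc n : compact_hausdorff :=
  CompactHausdorff (set_type_compact (@disc_compact n))
    (set_type_hausdorff (@rV_hausdorff n)).

(* [sphere n] is S^{n-1}. *)
Definition sphere n : compact_hausdorff :=
  CompactHausdorff (set_type_compact (@sphere_compact n))
    (set_type_hausdorff (@rV_hausdorff n)).

Definition sphere_incl n (x : sphere n) : disc n :=
  exist _ (set_val x) (mem_set (sphere_sub_disc (set_valP x))).

Lemma sphere_incl_continuous n : continuous (@sphere_incl n).
Proof. by apply: to_set_type_continuous; exact: set_val_continuous. Qed.

Definition contractible (T : topologicalType) : Prop :=
  exists (x0 : T) (H : (`[0 : R, 1]%classic : Type) * T -> T),
    [/\ continuous H,
        forall t x, set_val t = 0 -> H (t, x) = x &
        forall t x, set_val t = 1 -> H (t, x) = x0].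

End disc_sphere.

(* B arises from A by attaching n-cells. *)
Definition attaches_cells (R : realType) C (X : ispace C) (n : nat)
    (A B : sub_ispace X) (AB : sub_le A B) : Prop :=
  exists (I : choiceType) (c : I -> C)
    (phi : imap (cells c (sphere R n)) (ispace_of_sub A))
    (Phi : imap (cells c (disc R n)) (ispace_of_sub B)),
    is_pushout phi (cells_map c (@sphere_incl_continuous R n))
      (sub_incl AB) Phi.

(* The filtration is shifted: [skel n] is X_{n-1}, so [skel 0] is empty and
   [skel n.+1] is obtained from [skel n] by attaching n-cells. *)
Record icw_complex (R : realType) (C : small_category) := ICWComplex {
  icw_space :> ispace C;
  skel : nat -> sub_ispace icw_space;
  skel0 : forall a, sub_set (skel 0%N) a = set0;
  skel_le : forall n, sub_le (skel n) (skel n.+1);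
  skel_cover : forall a, \bigcup_n sub_set (skel n) a = setT;
  skel_colim : is_seq_colim skel_le;
  skel_attach : forall n, attaches_cells R n (@skel_le n)
}.

Definition two_dimensional R C (X : icw_complex R C) : Prop :=
  forall a, sub_set (skel X 3%N) a = setT.

Definition classifying_space R C (X : icw_complex R C) : Prop :=
  forall a, contractible R (X a).

(* Main.v *)
Require Import Defs.
From mathcomp Require Import all_boot all_order all_algebra all_classical all_reals.
From mathcomp Require Import topology normedtype realfun zify ring lra.

(** The model is the closed quadrant.  A morphism from [m] to a varying object
    is a pair of natural numbers, so the slice of [RF] under [m] is the poset
    [nat * nat], and the quadrant with its cubical structure (integer points,
    unit edges, unit squares) is a contractible complex with these vertices.
    Take the functor with the constant value [[0, oo) x [0, oo)], the morphism
    [(i, j)] acting as the translation by [(i, j)].  Then the vertices, the two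
    kinds of edges and the squares are carried freely to one another by the
    translations: for every object [n] and every shape of cell there is one
    free cell [mor(-, n) x D^k], whose copy indexed by [(p, q) : m -> n] is the cell with
    lower left corner [(p, q)].  The quadrant is convex, hence contractible by
    [quadrant_contractible].

    What has to be checked is that each stage of the filtration

      empty, integer points, integer grid, quadrant, quadrant, ...

    is a pushout of the preceding one.  Lemma [attaching_pushout] reduces this
    to set-theoretic conditions (the characteristic map covers the new points,
    is injective on them, and sends nothing but the spheres to the old points)
    and a single topological one: the characteristic map is closed.  Lemma
    [quadrant_attaches_cubes] deduces closedness from the local finiteness of
    the family of cells, each of which is compact, and leaves only elementary
    conditions on the parametrisations of the cells with corner the origin.

    The one non-obvious characteristic map is that of the square, as discs are
    round.  The map [(x, y) |-> (x, y * sqrt ((1 - |x|) / (1 + |x|)))] shrinks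
    each vertical chord of the disc linearly onto the vertical chord of the
    diamond [|x| + |y| <= 1], is bijective, continuous everywhere, and matches
    the boundaries; a similarity turns the diamond into the unit square. *)

Set Implicit Arguments.
Unset Strict Implicit.
Unset Printing Implicit Defensive.

Import Order.TTheory GRing.Theory Num.Theory.
Import numFieldNormedType.Exports.

Local Open Scope classical_set_scope.
Local Open Scope ring_scope.

(** * Closed subspaces *)

Lemma compact_set_val_preimage (T : topologicalType) (A K : set T) :
  closed A -> compact K -> compact (set_val @^-1` K : set A).
Proof.
move=> clA cK F FF FK.
have [|x [Kx clx]] := cK (set_val @ F) _; first exact: FK.
have Ax : A x.
  apply: clA => B Bx.
  have FA : (set_val @ F) A.
    apply: (@filterS _ F _ setT) => [y _|]; first exact: set_valP.
    exact: filterT.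
  by have [z [? ?]] := clx _ _ FA Bx; exists z.
exists (exist _ x (mem_set Ax)); split=> // P Q FP.
rewrite nbhsE => -[V [[W oW WV] Vx] VQ].
have Wx : nbhs x W by apply: open_nbhs_nbhs; split=> //; move: Vx; rewrite -WV.
have [y [[z Pz <-] Wz]] := clx _ _ (filterS (@preimage_image _ _ set_val P) FP) Wx.
by exists z; split=> //; apply: VQ; rewrite -WV.
Qed.

(** Local compactness in its weak form: every point has some compact
    neighbourhood.  For Hausdorff spaces this implies compact generation, and
    it passes to closed subspaces at once. *)
Definition locally_compact_hausdorff (T : topologicalType) : Prop :=
  hausdorff_space T /\ forall x : T, exists2 K, nbhs x K & compact K.

Lemma locally_compact_hausdorff_cg (T : topologicalType) :
  locally_compact_hausdorff T -> compactly_generated T.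
Proof. by case; exact: compact_nbhs_compactly_generated. Qed.

Lemma closed_locally_compact_hausdorff (T : topologicalType) (A : set T) :
  closed A -> locally_compact_hausdorff T -> locally_compact_hausdorff A.
Proof.
move=> clA [hT lT]; split; first exact: set_type_hausdorff.
move=> x; have [K Kx cK] := lT (set_val x).
exists (set_val @^-1` K); last exact: compact_set_val_preimage.
exact: set_val_continuous.
Qed.

Lemma plane_locally_compact_hausdorff (R : realType) :
  locally_compact_hausdorff (R * R)%type.
Proof.
split; first exact: (prod_hausdorff (@Rhausdorff R) (@Rhausdorff R)).
have nb (a : R) : nbhs a `[a - 1, a + 1]%classic.
  apply: filterS (@near_in_itvoo R (a - 1) (a + 1) a _) => [y|]; last first.
    by rewrite in_itv /=; lra.
  by move=> /subset_itv_oo_cc.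
move=> [a b]; exists (`[a - 1, a + 1] `*` `[b - 1, b + 1]).
  by exists (`[a - 1, a + 1]%classic, `[b - 1, b + 1]%classic) => //; split.
by apply: compact_setX; exact: segment_compact.
Qed.

Lemma closed_set_val_image (T : topologicalType) (A : set T) (W : set A) :
  closed A -> closed W -> closed (set_val @` W).
Proof.
move=> clA /closed_openC[O oO OW].
have -> : set_val @` W = A `&` ~` O.
  apply/seteqP; split=> x /=.
    case=> y Wy <-; split; first exact: set_valP.
    by move=> Oy; have : (~` W) y by rewrite -OW.
  case=> Ax nOx; exists (exist _ x (mem_set Ax)) => //.
  apply: contrapT => nW.
  have : (set_val @^-1` O) (exist _ x (mem_set Ax) : A) by rewrite OW.
  by [].
by apply: closedI => //; exact: open_closedC.
Qed.

Lemma closed_of_set_val_image (T : topologicalType) (A : set T) (W : set A) :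
  closed (set_val @` W) -> closed W.
Proof.
move=> clW.
have -> : W = set_val @^-1` (set_val @` W).
  apply/seteqP; split=> x /=; first by exists x.
  by case=> y Wy /val_inj <-.
by move/continuous_closedP: (@set_val_continuous _ A); exact.
Qed.

(** * A criterion for attaching cells *)

Section pushout.
Context (C : small_category) (X : ispace C) (A B : sub_ispace X).
Context (AB : sub_le A B) (I : choiceType) (c : I -> C).
Context (K L : compact_hausdorff) (h : K -> L) (ch : continuous h).
Variables (phi : imap (cells c K) (ispace_of_sub A))
  (Phi : imap (cells c L) (ispace_of_sub B)).

(* [Phi_old], [Phi_inj] and [Phi_cover] say that [Phi] restricts to a bijection
   from the complement of the image of [h] onto the complement of [A] in [B].
   Nothing is asked of [Phi] on the image of [h] beyond [square], so that
   boundaries of cells may be glued arbitrarily. *)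
Hypothesis clA : forall a, closed (sub_set A a).
Hypothesis square :
  imap_eq (imap_comp (sub_incl AB) phi) (imap_comp Phi (cells_map c ch)).
Hypothesis clPhi : forall a (W : set (cells c L a)),
  closed W -> closed [set set_val (Phi a s) | s in W].
Hypothesis Phi_old : forall a (s : cells c L a),
  sub_set A a (set_val (Phi a s)) -> exists k, s = cells_map c ch a k.
Hypothesis Phi_inj : forall a (s t : cells c L a),
  ~ sub_set A a (set_val (Phi a s)) -> Phi a s = Phi a t -> s = t.
Hypothesis Phi_cover : forall a (x : X a),
  sub_set B a x -> sub_set A a x \/ exists s, set_val (Phi a s) = x.

(** The induced map out of [B] is defined pointwise.  It is continuous because
    the preimage of a closed set is the union of a closed subset of [A] and of
    the image under [Phi] of a closed set. *)
Lemma attaching_pushout :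
  is_pushout phi (cells_map c ch) (sub_incl AB) Phi.
Proof.
split=> // Z u v uv.
(* [u] and [v] agree wherever both prescribe a value. *)
have agree a x s : sub_incl AB a x = Phi a s -> u a x = v a s.
  move=> xs; have As : sub_set A a (set_val (Phi a s)).
    by rewrite -xs; exact: (set_valP x).
  have [k ks] := Phi_old As; rewrite ks; move: (uv a k) => /= <-; congr (u a _).
  apply: val_inj; move: xs; rewrite ks.
  by move: (square k) => /= <- /(congr1 set_val).
have wP a (x : ispace_of_sub B a) : exists z : Z a,
    (forall y, sub_incl AB a y = x -> u a y = z) /\
    (forall s, Phi a s = x -> v a s = z).
  have [Ax|nAx] := pselect (sub_set A a (set_val x)).
    have Ex : sub_incl AB a (exist _ (set_val x) (mem_set Ax)) = x.
      exact: val_inj.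
    exists (u a (exist _ (set_val x) (mem_set Ax))); split.
      by move=> y Ey; congr (u a _); apply: val_inj; move: Ey => /(congr1 set_val).
    by move=> s Es; apply/esym/agree; rewrite Es.
  have [|[s Es]] := Phi_cover (set_valP x); first by [].
  have {}Es : Phi a s = x by exact: val_inj.
  exists (v a s); split; first by move=> y Ey; apply: agree; rewrite Ey.
  by move=> t Et; congr (v a _); apply/esym/Phi_inj; rewrite ?Es.
pose w a x := sval (cid (wP a x)).
have wu a y : w a (sub_incl AB a y) = u a y.
  by rewrite /w; case: (cid _) => z /= [-> ].
have wv a s : w a (Phi a s) = v a s.
  by rewrite /w; case: (cid _) => z /= [_ ->].
have cases a (x : ispace_of_sub B a) :
    (exists y, x = sub_incl AB a y) \/ (exists s, x = Phi a s).
  have [Ax|[s Es]] := Phi_cover (set_valP x); [left|right].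
    by exists (exist _ (set_val x) (mem_set Ax)); exact: val_inj.
  by exists s; exact: val_inj.
have cw a : continuous (w a).
  apply/continuous_closedP => W clW.
  have -> : w a @^-1` W = (sub_incl AB a @` (u a @^-1` W)) `|`
                          (Phi a @` (v a @^-1` W)).
    apply/seteqP; split=> x /=.
      by have [[y ->]|[s ->]] := cases a x; rewrite ?wu ?wv => Wx;
        [left; exists y|right; exists s].
    by case=> -[y Wy <-]; rewrite ?wu ?wv.
  apply: closedU; apply: closed_of_set_val_image; rewrite image_comp.
    apply: closed_set_val_image => //.
    by move/continuous_closedP: (@imap_continuous _ _ _ u a); exact.
  by apply: clPhi; move/continuous_closedP: (@imap_continuous _ _ _ v a); exact.
have nw a b (f : chom a b) (x : ispace_of_sub B b) :
    w a (ires f x) = ires f (w b x).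
  have [[y ->]|[s ->]] := cases b x.
    by rewrite -imap_natural !wu imap_natural.
  by rewrite -imap_natural !wv imap_natural.
exists (IMap cw nw); split=> //= w' w'u w'v a x /=.
by have [[y ->]|[s ->]] := cases a x; rewrite ?wu ?wv; [exact: w'u|exact: w'v].
Qed.

End pushout.

(** * Stationary filtrations *)

Lemma stationary_seq_colim (C : small_category) (X : ispace C)
    (A : nat -> sub_ispace X) (leA : forall n, sub_le (A n) (A n.+1)) N :
  (forall a, sub_set (A N) a = setT) -> is_seq_colim leA.
Proof.
move=> AN Z g gS.
have inA a (x : X a) : sub_set (A N) a x by rewrite AN.
have sub_up n k a : sub_set (A n) a `<=` sub_set (A (k + n)%N) a.
  by elim: k => [|k IH] // x /IH; exact: leA.
have up n k a (x : X a) (h : x \in sub_set (A n) a)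
    (h' : x \in sub_set (A (k + n)%N) a) :
    g (k + n)%N a (exist _ x h') = g n a (exist _ x h).
  elim: k h' => [|k IH] h'; first by congr (g n a _); exact: val_inj.
  have hk : x \in sub_set (A (k + n)%N) a.
    by apply: mem_set; apply: sub_up; exact: set_mem.
  rewrite -(IH hk) -(gS _ a (exist _ x hk)) /=.
  by congr (g _ a _); exact: val_inj.
pose incl a (x : X a) : ispace_of_sub (A N) a := exist _ x (mem_set (inA a x)).
have gincl n a (x : ispace_of_sub (A n) a) :
    g N a (incl a (set_val x)) = g n a x.
  case: x => x h; rewrite /incl /=.
  have h' : x \in sub_set (A (N + n)%N) a.
    by apply: mem_set; apply: sub_up; exact: set_mem.
  rewrite -(up n N a x h h'); move: h'; rewrite addnC => h'.
  exact/esym/up.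
have cincl a : continuous (incl a) by apply: to_set_type_continuous => x.
have wc a : continuous (fun x => g N a (incl a x)).
  move=> x; apply: (@continuous_comp _ _ _ (incl a)); first exact: cincl.
  exact: imap_continuous.
have wn a b (f : chom a b) (x : X b) :
    g N a (incl a (ires f x)) = ires f (g N b (incl b x)).
  by rewrite -imap_natural; congr (g N a _); exact: val_inj.
exists (IMap wc wn); split=> [n a x|w' w'g a x] /=; first exact: gincl.
by rewrite -(w'g N).
Qed.

(** * Continuity of functions given by formulas *)

Section continuity.
Context (R : realType) (T : topologicalType).

Lemma pair_continuous (S S' : topologicalType) (f : T -> S) (g : T -> S') :
  continuous f -> continuous g -> continuous (fun x => (f x, g x)).
Proof. by move=> cf cg x; apply: cvg_pair; [exact: cf|exact: cg]. Qed.

Lemma fst_continuous (S : topologicalType) : continuous (fst : T * S -> T).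
Proof. by move=> [x y]; exact: cvg_fst. Qed.

Lemma snd_continuous (S : topologicalType) : continuous (snd : S * T -> T).
Proof. by move=> [x y]; exact: cvg_snd. Qed.

Lemma comp_continuous (S S' : topologicalType) (f : T -> S) (g : S -> S') :
  continuous f -> continuous g -> continuous (fun x => g (f x)).
Proof. by move=> cf cg x; apply: continuous_comp; [exact: cf|exact: cg]. Qed.

Lemma add_fun_continuous (f g : T -> R) :
  continuous f -> continuous g -> continuous (fun x => f x + g x).
Proof. by move=> cf cg x; apply: (@continuousD R R); [exact: cf|exact: cg]. Qed.

Lemma mul_fun_continuous (f g : T -> R) :
  continuous f -> continuous g -> continuous (fun x => f x * g x).
Proof. by move=> cf cg x; apply: (@continuousM R); [exact: cf|exact: cg]. Qed.

Lemma opp_fun_continuous (f : T -> R) :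
  continuous f -> continuous (fun x => - f x).
Proof. by move=> cf x; apply: (@continuousN R R); exact: cf. Qed.

Lemma cst_fun_continuous (a : R) : continuous (fun _ : T => a).
Proof. by move=> x; exact: cvg_cst. Qed.

End continuity.

(** * The quadrant and its cubical filtration *)

Section quadrant.
Context (R : realType).
Notation plane := (R * R)%type.

(** The closed quadrant [[0, oo) x [0, oo)]. *)
Definition quadrant : set plane := [set z | 0 <= z.1 /\ 0 <= z.2].

(** Translation of the plane by a pair of natural numbers. *)
Definition translate (p : nat * nat) (z : plane) : plane :=
  (p.1%:R + z.1, p.2%:R + z.2).

Lemma translate_continuous p : continuous (translate p).
Proof.
by apply: pair_continuous; apply: add_fun_continuous;
  [exact: cst_fun_continuous|exact: fst_continuous
  |exact: cst_fun_continuous|exact: snd_continuous].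
Qed.

Lemma translate0 z : translate (0%N, 0%N) z = z.
Proof. by case: z => x y; rewrite /translate /= !add0r. Qed.

Lemma translateD p q z :
  translate ((p.1 + q.1)%N, (p.2 + q.2)%N) z = translate p (translate q z).
Proof. by rewrite /translate /= !natrD !addrA. Qed.

Lemma translate_quadrant p z : quadrant z -> quadrant (translate p z).
Proof. by case=> z1 z2; split; rewrite addr_ge0. Qed.

Lemma quadrant_closed : closed quadrant.
Proof.
rewrite (_ : quadrant = fst @^-1` [set t | 0 <= t] `&` snd @^-1` [set t | 0 <= t]) //.
apply: closedI.
  by move/continuous_closedP: (@fst_continuous R R); apply; exact: closed_ge.
by move/continuous_closedP: (@snd_continuous R R); apply; exact: closed_ge.
Qed.

Lemma quadrant_locally_compact_hausdorff : locally_compact_hausdorff quadrant.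
Proof.
exact: closed_locally_compact_hausdorff quadrant_closed
  (plane_locally_compact_hausdorff R).
Qed.

(** The action of a morphism [(i, j)]: translation by [(i, j)], the same for all
    sources and targets. *)
Definition quadrant_res (a b : RF) (f : chom a b) (x : quadrant) : quadrant :=
  exist _ (translate (\val f) (set_val x)) (mem_set (translate_quadrant _ (set_valP x))).

Lemma quadrant_res_continuous a b (f : @chom RF a b) :
  continuous (quadrant_res f).
Proof.
apply: to_set_type_continuous.
apply: (@comp_continuous _ _ _ set_val (translate (\val f))).
  exact: set_val_continuous.
exact: translate_continuous.
Qed.

Lemma quadrant_res_id (a : RF) x : quadrant_res (Defs.cid a) x = x.
Proof. by apply: val_inj; rewrite /= translate0. Qed.

Lemma quadrant_res_comp (a b c : RF) (f : chom a b) (g : chom b c) x :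
  quadrant_res (ccomp f g) x = quadrant_res f (quadrant_res g x).
Proof. by apply: val_inj; rewrite /= -translateD. Qed.

(** The functor on [RF] with constant value the quadrant, morphisms acting by
    translations. *)
Definition quadrant_space : ispace RF :=
  @ISpace RF (fun=> quadrant)
    (fun=> locally_compact_hausdorff_cg quadrant_locally_compact_hausdorff)
    quadrant_res quadrant_res_continuous quadrant_res_id quadrant_res_comp.

(** The quadrant is star-shaped about the origin. *)
Lemma quadrant_contractible : contractible R quadrant.
Proof.
have q0 : quadrant (0, 0) by split.
pose h (tx : (`[0 : R, 1]%classic : Type) * quadrant) : plane :=
  ((1 - set_val tx.1) * (set_val tx.2).1, (1 - set_val tx.1) * (set_val tx.2).2).
have hq tx : quadrant (h tx).
  case: tx => t x; have := set_valP t; rewrite /= in_itv /= => /andP[t0 t1].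
  by have [x1 x2] := set_valP x; split; rewrite mulr_ge0 ?subr_ge0.
exists (exist _ (0, 0) (mem_set q0)), (fun tx => exist _ (h tx) (mem_set (hq tx))).
split=> [|t x t0|t x t1]; last 2 first.
- by apply: val_inj; rewrite /= /h /= t0 subr0 !mul1r -surjective_pairing.
- by apply: val_inj; rewrite /= /h /= t1 subrr !mul0r.
apply: to_set_type_continuous.
have ct : continuous (fun tx : (`[0 : R, 1]%classic : Type) * quadrant =>
    1 - set_val tx.1).
  apply: add_fun_continuous; first exact: cst_fun_continuous.
  apply: opp_fun_continuous; apply: comp_continuous.
    exact: fst_continuous.
  exact: set_val_continuous.
have cx : continuous (fun tx : (`[0 : R, 1]%classic : Type) * quadrant =>
    set_val tx.2 : plane).
  apply: comp_continuous; first exact: snd_continuous.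
  exact: set_val_continuous.
apply: pair_continuous; apply: mul_fun_continuous => //.
  exact: comp_continuous cx (@fst_continuous _ _).
exact: comp_continuous cx (@snd_continuous _ _).
Qed.

(** The stages of the filtration, as subsets of the plane to be intersected with
    the quadrant; the index is shifted as in [skel], so that the integer points
    come at stage 1 and the grid at stage 2. *)
Definition skel_set (n : nat) : set plane :=
  match n with
  | 0 => set0
  | 1 => [set z | z.1 \is a Num.nat /\ z.2 \is a Num.nat]
  | 2 => [set z | z.1 \is a Num.nat \/ z.2 \is a Num.nat]
  | _ => setT
  end.

(** Natural numbers are compared below through estimates between reals. *)
Lemma natr_lt_add1 m n : m%:R < n%:R + 1 :> R -> (m <= n)%N.
Proof. by rewrite -[1]/(1%:R) -natrD ltr_nat addn1 ltnS. Qed.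

(** Distinct naturals are at distance at least 1. *)
Lemma nat_closed : closed [set x : R | x \is a Num.nat].
Proof.
move=> x clx.
have h0 : 0 < 2^-1 :> R by lra.
have [_ [/natrP[m ->] mx]] := clx _ (nbhsx_ballx x _ h0).
have [->|xm] := eqVneq x m%:R; first exact: natr_nat.
have d0 : 0 < Num.min 2^-1 `|x - m%:R|.
  by rewrite lt_min h0 normr_gt0 subr_eq0.
have [_ [/natrP[n ->]]] := clx _ (nbhsx_ballx x _ d0).
move: mx; rewrite /ball /= lt_min => mx /andP[nx nmx].
suff mn : m = n by move: nmx; rewrite mn ltxx.
move: mx nx; rewrite !ltr_norml => /andP[m1 m2] /andP[n1 n2].
by apply/eqP; rewrite eqn_leq; apply/andP; split; apply: natr_lt_add1; lra.
Qed.

Lemma skel_set_closed n : closed (skel_set n).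
Proof.
have cl1 : closed [set z : plane | z.1 \is a Num.nat].
  move/continuous_closedP: (@fst_continuous R R) => /(_ _ nat_closed).
  exact.
have cl2 : closed [set z : plane | z.2 \is a Num.nat].
  move/continuous_closedP: (@snd_continuous R R) => /(_ _ nat_closed).
  exact.
case: n => [|[|[|n]]] /=; [exact: closed0|exact: closedI|exact: closedU|].
exact: closedT.
Qed.

Lemma skel_set_le n : skel_set n `<=` skel_set n.+1.
Proof. by case: n => [|[|[|n]]] //= z [? ?]; left. Qed.

Lemma natD_nat m (x : R) :
  0 <= x -> (m%:R + x \is a Num.nat) = (x \is a Num.nat).
Proof.
move=> x0; apply/idP/idP => [/natrP[n mxn]|]; last exact: rpredD (natr_nat _ _).
have mn : (m <= n)%N by rewrite -(ler_nat R) -mxn lerDl.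
by have -> : x = (n - m)%:R by rewrite natrB // -mxn; ring.
Qed.

Lemma skel_set_translate n p z :
  quadrant z -> skel_set n (translate p z) <-> skel_set n z.
Proof.
by case=> z1 z2; case: n => [|[|[|n]]] //=; rewrite !natD_nat.
Qed.

(** The restriction of [skel_set n] to the quadrant, at every object. *)
Definition quadrant_skel (n : nat) : sub_ispace quadrant_space.
Proof.
refine (@SubISpace RF quadrant_space
  (fun=> [set x : quadrant | skel_set n (set_val x)]) _ _).
  by move=> a b f x /=; exact: (skel_set_translate n _ (set_valP x)).2.
move=> a; apply/locally_compact_hausdorff_cg/closed_locally_compact_hausdorff.
  move/continuous_closedP: (@set_val_continuous _ quadrant).
  by move=> /(_ _ (@skel_set_closed n)).
exact: quadrant_locally_compact_hausdorff.
Defined.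

Lemma quadrant_skel_le n : sub_le (quadrant_skel n) (quadrant_skel n.+1).
Proof. by move=> a x; exact: skel_set_le. Qed.

Lemma quadrant_skel_closed n a : closed (sub_set (quadrant_skel n) a).
Proof.
move/continuous_closedP: (@set_val_continuous _ quadrant).
by move=> /(_ _ (@skel_set_closed n)).
Qed.

(** * Attaching translates of finitely many cells *)

(* [J] is the set of shapes of the n-cells: one vertex, two edges, one square,
   and none in higher dimensions; [chi j] parametrises the cell of shape [j]
   whose lower left corner is the origin. *)
Section cubes.
Context (n : nat) (J : finType) (chi : J -> disc R n -> plane).
Hypothesis chi_continuous : forall j, continuous (chi j).
Hypothesis chi_quadrant : forall j d, quadrant (chi j d).

(* One free cell of each shape for every object of [RF]. *)
Let c (i : nat * J) : RF := i.1.

Lemma RF_hom_of_subproof (a : nat) (p : nat * nat) :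
  (p.1 + p.2)%N%:Z == (a + (p.1 + p.2))%N%:Z - a%:Z.
Proof. lia. Qed.

(** The pair [p], as a morphism out of [a]. *)
Definition RF_hom_of a p : RF_hom a (a + (p.1 + p.2)) :=
  exist _ p (RF_hom_of_subproof a p).

(** The point [d] of the copy of [L] of shape [j] and corner [p].  The target of
    the morphism [p] out of [a] is determined by [p], so that at each object
    the points of [cells c L] are exactly the triples [(p, j, d)]; see
    [cubeP]. *)
Definition cube (L : compact_hausdorff) (a : RF) (p : nat * nat) (j : J) (d : L) :
    cells c L a :=
  existT _ ((a + (p.1 + p.2))%N, j) (RF_hom_of a p, d).

Lemma cubeP (L : compact_hausdorff) a (s : cells c L a) :
  exists p j d, s = cube a p j d.
Proof.
case: s => -[m j] [[p h] d]; exists p, j, d.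
have Em : m = (a + (p.1 + p.2))%N by move: (h) => /=; lia.
move: h; rewrite /c /= Em => h; congr existT; congr pair.
exact: val_inj.
Qed.

(** The corner of the cell that contains [s]. *)
Definition cell_pos (L : compact_hausdorff) (a : RF) (s : cells c L a) : nat * nat :=
  \val ((projT2 s).1 : RF_hom a (projT1 s).1).

(** The characteristic map: [chi], translated to the corner of the cell. *)
Definition cell_fun a (s : cells c (disc R n) a) : plane :=
  translate (cell_pos s) (chi (projT1 s).2 (projT2 s).2).

Lemma cell_fun_continuous a : continuous (@cell_fun a).
Proof.
move=> [[m j] y].
pose D := discrete_topology (RF_hom a m : choiceType).
suff /(_ y) : continuous (fun x : (D * disc R n)%type =>
   translate (\val (x.1 : RF_hom a m)) (chi j x.2)) by [].
have cD (f : RF_hom a m -> R) :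
    continuous (fun x : (D * disc R n)%type => f x.1).
  apply: (@comp_continuous _ _ _ fst (f : D -> R)).
    exact: fst_continuous.
  exact: discrete_continuous.
have cchi : continuous (fun x : (D * disc R n)%type => chi j x.2).
  exact: comp_continuous (@snd_continuous _ _) (@chi_continuous j).
apply: pair_continuous; apply: add_fun_continuous.
- exact: (cD (fun f => (\val f).1%:R)).
- exact: comp_continuous cchi (@fst_continuous _ _).
- exact: (cD (fun f => (\val f).2%:R)).
- exact: comp_continuous cchi (@snd_continuous _ _).
Qed.

Lemma cell_fun_cube a p j d : cell_fun (cube a p j d) = translate p (chi j d).
Proof. by []. Qed.

Lemma cube_continuous (L : compact_hausdorff) a p j :
  continuous (@cube L a p j).
Proof.
pose D := discrete_topology (@chom RF a (c ((a + (p.1 + p.2))%N, j))).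
apply: (@comp_continuous _ (D * L)%type _ (fun d => (RF_hom_of a p : D, d))
  (existT (fun i => (discrete_topology (@chom RF a (c i)) * L)%type)
    ((a + (p.1 + p.2))%N, j))); last first.
  have := (@existT_continuous (nat * J)%type
    (fun i => (discrete_topology (@chom RF a (c i)) * L)%type : topologicalType))
    ((a + (p.1 + p.2))%N, j).
  exact.
by apply: pair_continuous => x; [exact: cvg_cst|].
Qed.

(** Near a point of the plane only finitely many cells are met, and each of them
    contributes a compact set. *)
Lemma cell_fun_closed a (W : set (cells c (disc R n) a)) :
  closed W -> closed [set cell_fun s | s in W].
Proof.
move=> clW z clz.
pose N := Num.bound (`|z.1| + `|z.2|).
have zN : `|z.1| + `|z.2| < N%:R by apply: archi_boundP; rewrite addr_ge0.
have z1N : z.1 < N%:R by have := ler_norm z.1; have := normr_ge0 z.2; lra.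
have z2N : z.2 < N%:R by have := ler_norm z.2; have := normr_ge0 z.1; lra.
(* In [V] only cells with both coordinates of the corner below [N] are met. *)
pose V : set plane := [set w | w.1 < N%:R /\ w.2 < N%:R].
have Vz : nbhs z V.
  apply: filterI; first exact: (@fst_continuous R R z _ (lt_nbhsl z1N)).
  exact: (@snd_continuous R R z _ (lt_nbhsl z2N)).
pose piece (k : 'I_N * 'I_N * J) : set plane :=
  (fun d => translate (k.1.1 : nat, k.1.2 : nat) (chi k.2 d)) @`
    [set d | W (cube a (k.1.1 : nat, k.1.2 : nat) k.2 d)].
have cl_piece k : closed (piece k).
  apply: compact_closed; first exact: (prod_hausdorff (@Rhausdorff R) (@Rhausdorff R)).
  apply: continuous_compact.
    apply: continuous_subspaceT.
    exact: comp_continuous (@chi_continuous _) (@translate_continuous _).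
  apply: (subclosed_compact _ (@ch_compact (disc R n))) => //.
  move/continuous_closedP:
    (@cube_continuous (disc R n) a (k.1.1 : nat, k.1.2 : nat) k.2).
  exact.
have /(_ z) : closed (\bigcup_(k in setT) piece k).
  by apply: closed_bigcup => [|k _]; [exact: finite_finset|exact: cl_piece].
case=> [B Bz|k _ [d Wd <-]]; last by eexists; [exact: Wd|].
have [_ [[s Ws <-] [Bs [s1 s2]]]] := clz _ (filterI Bz Vz).
have [p [j [d E]]] := cubeP s; subst s.
exists (cell_fun (cube a p j d)); split=> //.
have [c1 c2] := chi_quadrant j d.
have p1 : (p.1 < N)%N.
  by rewrite -(ltr_nat R); move: s1; rewrite cell_fun_cube /=; lra.
have p2 : (p.2 < N)%N.
  by rewrite -(ltr_nat R); move: s2; rewrite cell_fun_cube /=; lra.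
by exists (Ordinal p1, Ordinal p2, j) => //; exists d; rewrite /= -surjective_pairing.
Qed.

Hypothesis chi_sphere : forall j (k : sphere R n),
  skel_set n (chi j (sphere_incl k)).
Hypothesis chi_disc : forall j d, skel_set n.+1 (chi j d).
Hypothesis chi_old : forall j d, skel_set n (chi j d) -> sqnorm (set_val d) = 1.
Hypothesis chi_inj : forall p q i j d e, ~ skel_set n (chi i d) ->
  translate p (chi i d) = translate q (chi j e) -> [/\ p = q, i = j & d = e].
Hypothesis chi_cover : forall z, quadrant z -> skel_set n.+1 z ->
  ~ skel_set n z -> exists p j d, z = translate p (chi j d).

(** All conditions are about the cells at the origin, except that [chi_inj] and
    [chi_cover] involve all the translates. *)
Lemma quadrant_attaches_cubes : attaches_cells R n (@quadrant_skel_le n).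
Proof.
exists (nat * J)%type, c.
have q_s a (s : cells c (disc R n) a) : quadrant (cell_fun s).
  exact: translate_quadrant.
pose base a (s : cells c (disc R n) a) : quadrant_space a :=
  exist _ (cell_fun s) (mem_set (q_s a s)).
have cbase a : continuous (base a).
  by apply: to_set_type_continuous; exact: cell_fun_continuous.
have base_nat a b (f : chom a b) s : base a (ires f s) = ires f (base b s).
  by apply: val_inj; rewrite /= -translateD.
have PhiB a s : sub_set (quadrant_skel n.+1) a (base a s).
  by apply/skel_set_translate => //; exact: chi_disc.
have phiA a k : sub_set (quadrant_skel n) a
    (base a (cells_map c (@sphere_incl_continuous R n) a k)).
  by apply/skel_set_translate => //; exact: chi_sphere.
pose Phi_fun a s : ispace_of_sub (quadrant_skel n.+1) a :=
  exist _ (base a s) (mem_set (PhiB a s)).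
pose phi_fun a k : ispace_of_sub (quadrant_skel n) a :=
  exist _ (base a (cells_map c (@sphere_incl_continuous R n) a k))
    (mem_set (phiA a k)).
have Phi_c a : continuous (Phi_fun a).
  by apply: to_set_type_continuous; exact: cbase.
have phi_c a : continuous (phi_fun a).
  apply: to_set_type_continuous.
  by apply: (comp_continuous _ (cbase a)); exact: imap_continuous.
have Phi_n a b (f : chom a b) s : Phi_fun a (ires f s) = ires f (Phi_fun b s).
  by apply: val_inj => /=; exact: base_nat.
have phi_n a b (f : chom a b) s : phi_fun a (ires f s) = ires f (phi_fun b s).
  apply: val_inj.
  exact: (base_nat a b f (cells_map c (@sphere_incl_continuous R n) b s)).
exists (IMap phi_c phi_n), (IMap Phi_c Phi_n).
apply: attaching_pushout.
- by move=> a; exact: quadrant_skel_closed.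
- by move=> a k; exact: val_inj.
- move=> a W clW; apply: closed_of_set_val_image; rewrite image_comp.
  exact: cell_fun_closed.
- move=> a s; have [p [j [d ->]]] := cubeP s => /=.
  move=> /skel_set_translate => /(_ (chi_quadrant j d)) /chi_old d1.
  pose k : sphere R n := exist _ (set_val d) (mem_set d1).
  by exists (cube a p j k); congr existT; congr pair; exact: val_inj.
- move=> a s t; have [p [j [d ->]]] := cubeP s; have [q [i [e ->]]] := cubeP t.
  move=> nA /(congr1 (fun x => set_val (set_val x))) E.
  have nd : ~ skel_set n (chi j d).
    by apply: contra_not nA => ?; exact/skel_set_translate.
  by have [-> -> ->] := @chi_inj p q j i d e nd E.
- move=> a x Bx; have [?|nA] := pselect (sub_set (quadrant_skel n) a x); first by left.
  have [p [j [d E]]] := chi_cover (set_valP x) Bx nA; right.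
  by exists (cube a p j d); apply: val_inj; rewrite /= E.
Qed.

End cubes.

End quadrant.

(** * Integral and fractional parts *)

Section unit_interval.
Context (R : realType).
Implicit Types s t x : R.

(** [t] may be 1: this still determines the integral part, as [s] is neither 0
    nor 1. *)
Lemma natrD_inj m n s t : 0 < s < 1 -> 0 <= t <= 1 ->
  m%:R + s = n%:R + t -> m = n /\ s = t.
Proof.
move=> /andP[s0 s1] /andP[t0 t1] E.
have mn : m = n.
  by apply/eqP; rewrite eqn_leq; apply/andP; split;
    apply: (@natr_lt_add1 R); lra.
by split=> //; move: E; rewrite mn => /addrI.
Qed.

Lemma unit_itv_natNP t : 0 <= t <= 1 -> t \isn't a Num.nat <-> 0 < t < 1.
Proof.
move=> /andP[t0 t1]; split.
  move=> tN; rewrite !lt_neqAle t0 t1 !andbT; apply/andP; split.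
    by apply: contraNneq tN => <-; exact: rpred0.
  by apply: contraNneq tN => ->; exact: rpred1.
move=> /andP[t0' t1']; apply/negP => /natrP[n tn].
have : (n <= 0)%N by apply: (@natr_lt_add1 R); lra.
by case: n tn => // tn; lra.
Qed.

Lemma nat_frac x : 0 <= x -> exists n t, x = n%:R + t /\ 0 <= t < 1.
Proof.
move=> /truncn_itv /andP[h1 h2]; exists (Num.trunc x), (x - (Num.trunc x)%:R).
by move: h2; rewrite -addn1 natrD => h2; split; [ring|lra].
Qed.

End unit_interval.

(** * Vertices, edges and squares *)

Section characteristic_maps.
Context (R : realType).
Notation plane := (R * R)%type.

Definition disc_point n (v : 'rV[R]_n) (h : sqnorm v <= 1) : disc R n :=
  exist _ v (mem_set h).

Lemma disc_coord_continuous n i :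
  continuous (fun d : disc R n => set_val d 0 i : R).
Proof.
apply: (@comp_continuous _ _ _ set_val (fun v : 'rV[R]_n => v 0 i)).
  exact: set_val_continuous.
exact: coord_continuous.
Qed.

Lemma attach_vertices : attaches_cells R 0 (@quadrant_skel_le R 0).
Proof.
apply: (@quadrant_attaches_cubes _ 0 unit (fun _ _ => (0, 0))) => //=.
- by move=> _; apply: cst_continuous.
- by move=> _ k; have := set_valP k; rewrite /sphere_set /sqnorm /= big_ord0; lra.
- move=> [p1 p2] [q1 q2] [] [] d e _; rewrite /translate /= !addr0 => -[/eqP + /eqP].
  rewrite !eqr_nat => /eqP -> /eqP ->; split=> //.
  by apply: val_inj; apply/rowP => -[].
- move=> [x y] _ /= [/natrP[p ->] /natrP[q ->]] _.
  have h : sqnorm (0 : 'rV[R]_0) <= 1 by rewrite /sqnorm big_ord0.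
  by exists (p, q), tt, (disc_point h); rewrite /translate /= !addr0.
Qed.

Lemma sqnorm1 (v : 'rV[R]_1) : sqnorm v = v 0 0 ^+ 2.
Proof. by rewrite /sqnorm big_ord1. Qed.

(** The affine identification of the 1-disc [[-1, 1]] with [[0, 1]]. *)
Definition seg_param (d : disc R 1) : R := (1 + set_val d 0 0) / 2.

Lemma seg_param_itv d : 0 <= seg_param d <= 1.
Proof.
have := set_valP d; rewrite /disc_set /= sqnorm1 /seg_param => h.
by apply/andP; split; nra.
Qed.

Lemma seg_param_inj : injective seg_param.
Proof.
move=> d e; rewrite /seg_param => h; apply: val_inj; apply/rowP => i.
by rewrite ord1; lra.
Qed.

(** The horizontal ([true]) and the vertical ([false]) unit edge at the origin. *)
Definition edge (b : bool) (d : disc R 1) : plane :=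
  if b then (seg_param d, 0) else (0, seg_param d).

Lemma attach_edges : attaches_cells R 1 (@quadrant_skel_le R 1).
Proof.
have ends d : seg_param d \is a Num.nat <-> sqnorm (set_val d) = 1.
  have := seg_param_itv d => h; rewrite sqnorm1.
  split.
    move=> hn; have [h1 h2] := unit_itv_natNP h.
    apply: contrapT => n1.
    suff : seg_param d \isn't a Num.nat by rewrite hn.
    apply: h2; move: h; rewrite /seg_param !le_eqVlt => /andP[].
    case/orP=> [/eqP ?|h0]; first by case: n1; nra.
    case/orP=> [/eqP ?|h1']; first by case: n1; nra.
    by rewrite h0.
  rewrite /seg_param => h1.
  have /orP[/eqP ->|/eqP ->] : (set_val d 0 0 == 1) || (set_val d 0 0 == -1).
    by rewrite -eqf_sqr h1 expr1n.
  - by rewrite (_ : (1 + 1) / 2 = 1 :> R) ?rpred1//; lra.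
  - by rewrite subrr mul0r rpred0.
apply: (@quadrant_attaches_cubes _ 1 bool edge).
- have c : continuous seg_param.
    apply: mul_fun_continuous; last exact: cst_fun_continuous.
    apply: add_fun_continuous; first exact: cst_fun_continuous.
    exact: disc_coord_continuous.
  by case; apply: pair_continuous => //; exact: cst_fun_continuous.
- by move=> [] d; have /andP[? ?] := seg_param_itv d.
- move=> b k; have /ends hk : sqnorm (set_val (sphere_incl k)) = 1 by exact: (set_valP k).
  by case: b; split=> //=; exact: rpred0.
- by move=> [] d /=; [right|left]; exact: rpred0.
- by move=> [] d /= [? ?]; exact/ends.
- move=> [p1 p2] [q1 q2] i j d e nd.
  have hd : 0 < seg_param d < 1.
    apply/(unit_itv_natNP (seg_param_itv d)); apply/negP => hn; apply: nd.
    by case: i; split=> //=; exact: rpred0.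
  have he := seg_param_itv e.
  have h0 : 0 <= (0 : R) <= 1 by rewrite lexx ler01.
  have inj (m m' k k' : nat) : m%:R + seg_param d = m'%:R + seg_param e ->
      k%:R + 0 = k'%:R + 0 :> R -> [/\ m = m', k = k' & d = e].
    move=> /(natrD_inj hd he)[-> /seg_param_inj ->] /addIr/eqP.
    by rewrite eqr_nat => /eqP ->.
  have sep (m m' : nat) : m%:R + seg_param d = m'%:R + 0 -> False.
    by move=> /(natrD_inj hd h0)[_ hd0]; move: hd; rewrite hd0 ltxx.
  case: i j {nd} => -[] [E1 E2].
  + by have [-> -> ->] := inj _ _ _ _ E1 E2.
  + by case: (sep _ _ E1).
  + by case: (sep _ _ E2).
  + by have [-> -> ->] := inj _ _ _ _ E2 E1.
- have preim t : 0 <= t < 1 -> exists d, seg_param d = t.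
    move=> /andP[t0 t1].
    have h : sqnorm (const_mx (2 * t - 1) : 'rV[R]_1) <= 1.
      by rewrite sqnorm1 mxE; nra.
    by exists (disc_point h); rewrite /seg_param /= mxE; lra.
  move=> [x y] /= [x0 y0] [/natrP[m ->]|/natrP[m ->]] _.
  + have [n [t [-> /preim[d <-]]]] := nat_frac (y0 : 0 <= y).
    by exists (m, n), false, d; rewrite /translate /= addr0.
  + have [n [t [-> /preim[d <-]]]] := nat_frac (x0 : 0 <= x).
    by exists (n, m), true, d; rewrite /translate /= addr0.
Qed.

Lemma sqnorm2 (v : 'rV[R]_2) : sqnorm v = v 0 0 ^+ 2 + v 0 1 ^+ 2.
Proof.
by rewrite /sqnorm big_ord_recl big_ord1; congr (_ + v 0 _ ^+ 2); exact: val_inj.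
Qed.

(** The ratio of the heights of the diamond [|x| + |y| <= 1] and of the unit disc
    above the abscissa [x]: this is [(1 - |x|) / sqrt (1 - x ^ 2)], written so
    as to be continuous also at [x = 1] and [x = -1]. *)
Definition squeeze (x : R) : R := Num.sqrt ((1 - `|x|) / (1 + `|x|)).

(** The second coordinate of the point of the diamond that corresponds to the
    point [(x, y)] of the disc. *)
Definition height (x y : R) : R := y * squeeze x.

(** For [|x| < 1] the point [(x, y)] is inside, on, or outside the circle exactly
    when [(x, height x y)] is so with respect to the diamond. *)
Lemma heightE x y : `|x| <= 1 ->
  ((1 - `|x|) ^+ 2 - height x y ^+ 2) * (1 + `|x|) =
  (1 - `|x|) * (1 - (x ^+ 2 + y ^+ 2)).
Proof.
move=> x1; have x0 := normr_ge0 x.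
rewrite /height exprMn sqr_sqrtr; last by rewrite divr_ge0; lra.
rewrite -(real_normK (num_real x)); field.
by rewrite gt_eqF//; lra.
Qed.

Lemma squeeze_gt0 x : `|x| < 1 -> 0 < squeeze x.
Proof.
by move=> x1; have x0 := normr_ge0 x; rewrite sqrtr_gt0 divr_gt0 //; lra.
Qed.

Lemma squeeze_continuous : continuous squeeze.
Proof.
apply: comp_continuous; last exact: sqrt_continuous.
have cn : continuous (fun x : R => `|x|) by exact: norm_continuous.
apply: mul_fun_continuous.
  apply: add_fun_continuous; first exact: cst_fun_continuous.
  exact: opp_fun_continuous.
have c1 : continuous (fun x : R => 1 + `|x|).
  by apply: add_fun_continuous => //; exact: cst_fun_continuous.
move=> x; apply: (@continuousV R R (fun x => 1 + `|x|) x) (c1 x).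
by have := normr_ge0 x => ?; rewrite gt_eqF//; lra.
Qed.

(** The characteristic map of the unit square at the origin: the disc is
    squeezed onto the diamond, which is then mapped to the square by the
    similarity [(x, y) |-> ((1 + x + y) / 2, (1 + x - y) / 2)]. *)
Definition square (d : disc R 2) : plane :=
  let x := set_val d 0 0 in
  let y := height x (set_val d 0 1) in ((1 + x + y) / 2, (1 + x - y) / 2).

Lemma square_continuous : continuous square.
Proof.
have c0 := @disc_coord_continuous 2 0; have c1 := @disc_coord_continuous 2 1.
have ch : continuous (fun d : disc R 2 => height (set_val d 0 0) (set_val d 0 1)).
  apply: mul_fun_continuous => //.
  exact: (comp_continuous c0 squeeze_continuous).
have cx : continuous (fun d : disc R 2 => 1 + set_val d 0 0).
  by apply: add_fun_continuous => //; exact: cst_fun_continuous.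
apply: pair_continuous; apply: mul_fun_continuous;
  try exact: cst_fun_continuous; apply: add_fun_continuous => //.
exact: opp_fun_continuous.
Qed.

(** The squeezed disc lies in the diamond. *)
Lemma disc2_coord (d : disc R 2) : let x := set_val d 0 0 in
  `|x| <= 1 /\ `|height x (set_val d 0 1)| <= 1 - `|x|.
Proof.
move=> x; have := set_valP d; rewrite /disc_set /= sqnorm2 -/x.
set y := set_val d 0 1 => xy.
have x1 : `|x| <= 1 by rewrite ler_norml; apply/andP; split; nra.
split=> //; have x0 := normr_ge0 x.
rewrite -(ler_pXn2r (n := 2)) ?nnegrE ?subr_ge0// real_normK ?num_real//.
rewrite -subr_ge0 -(pmulr_lge0 _ (_ : 0 < 1 + `|x|)); last by lra.
by rewrite heightE// mulr_ge0 ?subr_ge0.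
Qed.

Lemma square_itv d : 0 <= (square d).1 <= 1 /\ 0 <= (square d).2 <= 1.
Proof.
have := disc2_coord d; rewrite /square /=.
set x := set_val d 0 0; set y := height _ _.
rewrite !ler_norml => -[/andP[? ?] /andP[]].
by have [] := ger0P x => ? ? ?; split; apply/andP; split; lra.
Qed.

Lemma square_boundary d :
  skel_set 2 (square d) <-> sqnorm (set_val d) = 1.
Proof.
have [h1 h2] := square_itv d.
have [_ u1] := unit_itv_natNP h1; have [_ u2] := unit_itv_natNP h2.
have := disc2_coord d; have := @heightE (set_val d 0 0) (set_val d 0 1).
have := set_valP d; rewrite /disc_set /= !sqnorm2.
move: u1 u2 {h1 h2}; rewrite /square /=.
set x := set_val d 0 0; set y := set_val d 0 1; set z := height x y.
move=> u1 u2 xy /[swap] -[x1 z1] /(_ x1); have x0 := normr_ge0 x.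
rewrite -[z ^+ 2]real_normK ?num_real// => E; split.
  move=> ab; apply: contrapT => /eqP nxy.
  have {nxy}xy1 : x ^+ 2 + y ^+ 2 < 1 by rewrite lt_neqAle nxy.
  have {}x1 : `|x| < 1 by rewrite ltr_norml; apply/andP; split; nra.
  have {E z1}z1 : `|z| < 1 - `|x|.
    rewrite -(ltr_pXn2r (n := 2)) ?nnegrE ?subr_ge0 ?(ltW x1)// -subr_gt0.
    rewrite -(pmulr_lgt0 _ (_ : 0 < 1 + `|x|)); last by lra.
    by rewrite E mulr_gt0 ?subr_gt0.
  move: z1; rewrite ltr_norml => /andP[]; have [x2|x2] := ger0P x => z1 z2;
    by case: ab; apply/negP; first [apply: u1|apply: u2]; apply/andP; split; lra.
move=> xy1; move: E; rewrite xy1 subrr mulr0 => /eqP.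
rewrite mulf_eq0 (gt_eqF (_ : 0 < 1 + `|x|)) ?orbF ?subr_eq0; last by lra.
rewrite eqrXn2 ?subr_ge0// => /eqP.
have n0 : (0 : R) \is a Num.nat by exact: rpred0.
have n1 : (1 : R) \is a Num.nat by exact: rpred1.
have [x2|x2] := ger0P x; have [z2|z2] := ger0P z => E; [left|right|right|left].
- by rewrite (_ : _ / 2 = 1)//; lra.
- by rewrite (_ : _ / 2 = 1)//; lra.
- by rewrite (_ : _ / 2 = 0)//; lra.
- by rewrite (_ : _ / 2 = 0)//; lra.
Qed.

Lemma attach_squares : attaches_cells R 2 (@quadrant_skel_le R 2).
Proof.
apply: (@quadrant_attaches_cubes _ 2 unit (fun=> square)).
- by move=> _; exact: square_continuous.
- by move=> _ d; have [/andP[? _] /andP[? _]] := square_itv d.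
- by move=> _ k; apply/square_boundary; exact: (set_valP k).
- by [].
- by move=> _ d /square_boundary.
- move=> [p1 p2] [q1 q2] [] [] d e nd.
  have [h1 h2] := square_itv d; have [h1' h2'] := square_itv e.
  have {}h1 : 0 < (square d).1 < 1.
    by apply/(unit_itv_natNP h1)/negP => hn; apply: nd; left.
  have {}h2 : 0 < (square d).2 < 1.
    by apply/(unit_itv_natNP h2)/negP => hn; apply: nd; right.
  case=> /(natrD_inj h1 h1')[-> E1] /(natrD_inj h2 h2')[-> E2]; split=> //.
  have Ex : set_val d 0 0 = set_val e 0 0 by move: E1 E2; rewrite /square /=; lra.
  have x1 : `|set_val d 0 0| < 1.
    move: h1 h2; rewrite /square /= ltr_norml => /andP[? ?] /andP[? ?].
    by apply/andP; split; lra.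
  have Eh : height (set_val d 0 0) (set_val d 0 1) =
            height (set_val d 0 0) (set_val e 0 1).
    by move: E1; rewrite /square /= Ex; lra.
  have Ey : set_val d 0 1 = set_val e 0 1.
    by move: Eh; apply: mulIf; rewrite gt_eqF ?squeeze_gt0.
  apply: val_inj; apply/rowP => i.
  have /orP[/eqP ->|/eqP ->] // : (i == 0) || (i == 1).
  by case: i => -[|[|]].
- (* The inverse of [square] on the interior of the square: undo the similarity,
     then divide the second coordinate by [squeeze]. *)
  move=> [x y] /= [x0 y0] _ nN.
  have [p [s [Es s01]]] := nat_frac (x0 : 0 <= x).
  have [q [t [Et t01]]] := nat_frac (y0 : 0 <= y).
  have s01' : 0 <= s <= 1 by case/andP: s01 => -> /ltW.
  have t01' : 0 <= t <= 1 by case/andP: t01 => -> /ltW.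
  have /andP[sl sr] : 0 < s < 1.
    apply/(unit_itv_natNP s01')/negP => hn; apply: nN; left.
    by rewrite Es; exact: rpredD (natr_nat _ _) hn.
  have /andP[tl tr] : 0 < t < 1.
    apply/(unit_itv_natNP t01')/negP => hn; apply: nN; right.
    by rewrite Et; exact: rpredD (natr_nat _ _) hn.
  pose a := s + t - 1.
  have a1 : `|a| < 1 by rewrite ltr_norml /a; apply/andP; split; lra.
  have r0 := squeeze_gt0 a1.
  pose b := (s - t) / squeeze a.
  have Eb : height a b = s - t by rewrite /height /b divfK ?gt_eqF.
  pose v : 'rV[R]_2 := \row_i (if i == 0 then a else b).
  have h : sqnorm v <= 1.
    rewrite sqnorm2 !mxE /= -subr_ge0 -(pmulr_rge0 _ (_ : 0 < 1 - `|a|)); last by lra.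
    rewrite -heightE ?(ltW a1)// Eb mulr_ge0//; last by have := normr_ge0 a; lra.
    rewrite subr_ge0 -(real_normK (num_real (s - t))) ler_pXn2r ?nnegrE//; last lra.
    by rewrite ler_norml /a; have [] := ger0P (s + t - 1) => ?; apply/andP; split; lra.
  exists (p, q), tt, (disc_point h).
  rewrite /square /translate /= !mxE /= Eb Es Et /a.
  by congr pair; field.
Qed.

Lemma attach_nothing n : attaches_cells R n.+3 (@quadrant_skel_le R n.+3).
Proof.
by apply: (@quadrant_attaches_cubes _ n.+3 void (fun _ _ => (0, 0))) => // -[].
Qed.

(** The quadrant with its integer points, unit edges and unit squares. *)
Definition quadrant_complex : icw_complex R RF.
Proof.
apply: (@ICWComplex R RF (quadrant_space R) (@quadrant_skel R) _
  (@quadrant_skel_le R)) => [a|a||].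
- by apply/seteqP; split.
- by apply/seteqP; split=> // x _; exists 3%N.
- by apply: (@stationary_seq_colim _ _ _ _ 3) => a; apply/seteqP; split.
- case=> [|[|[|n]]]; [exact: attach_vertices|exact: attach_edges
    |exact: attach_squares|exact: attach_nothing].
Defined.

End characteristic_maps.

Theorem proposition7p3 (R : realType) :
  exists X : icw_complex R RF, classifying_space X /\ two_dimensional X.
Proof.
exists (quadrant_complex R); split=> a; first exact: quadrant_contractible.
by apply/seteqP; split.
Qed.
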